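(* For $n\ge0$ let $m_n$ be the number of reduced unit interval graphs on $[n]$; $r_n$ the number of connected reduced unit interval graphs on $[n]$; $t_n$ the number of reduced $2$-nested unit interval graphs on $[n]$; and $f_n$ the number of connected reduced $2$-nested unit interval graphs on $[n]$. Then (i) $m_0=1$ and $m_n=M_{n-1}$ for $n\ge1$, where $M_k$ is the $k$th Motzkin number; (ii) $r_0=0$ and $r_n=R_{n-1}$ for $n\ge1$, where $R_k$ is the $k$th Riordan number; (iii) $t_0=1$, $t_1=1$ and $t_n=2^{n-2}$ for $n\ge2$; (iv) $f_0=0$, $f_1=1$ and $f_n=F_{n-2}$ for $n\ge2$, where $F_k$ is the $k$th Fibonacci number.
   Context: Write $[n]=\{1,\dots,n\}$. An area sequence of size $n$ is a sequence $\mathbf a=(a_1,\dots,a_n)$ of nonnegative integers with $a_i<i$ for all $i$ and $a_i\le a_{i-1}+1$ for all $i\ge 2$. It defines a graph $\Gamma_{\mathbf a}$ on $[n]$ with edges $\{j,i\}$ for $1\le j<i\le n$ with $i-a_i\le j$. The unit interval graphs on $[n]$ are the labeled graphs $\Gamma_{\mathbf a}$, and counting them means counting the corresponding area sequences. For $n=0$ there is a single (empty) graph, which is by convention reduced and $2$-nested but not connected. $\Gamma_{\mathbf a}$ is reduced if there are no two adjacent vertices $j,j+1$ with $N(j)\setminus\{j+1\}=N(j+1)\setminus\{j\}$, where $N(i)$ is the set of neighbors of $i$. If $\{i,j\}$ with $i<j$ is an edge then $\{i,\dots,j\}$ is a clique. A peak-edge is either an isolated vertex $i$ (put $j=i$)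 or an edge $\{i,j\}$, $i<j$, such that neither $\{i,j+1\}$ nor $\{i-1,j\}$ is an edge (pairs not contained in $[n]$ are not edges); the corresponding peak-clique is $\{i,\dots,j\}$. $\Gamma_{\mathbf a}$ is $2$-nested if every vertex lies in at most $2$ peak-cliques. The Motzkin number $M_k$ is the number of Motzkin paths of length $k$, i.e. lattice paths from $(0,0)$ to $(k,0)$ with steps $(1,1),(1,-1),(1,0)$ never going below the $x$-axis. The Riordan number $R_k$ (OEIS A005043: $1,0,1,1,3,6,15,\dots$, $k\ge0$) is the number of Motzkin paths of length $k$ with no horizontal step at height $0$. $F_0=0$, $F_1=1$, $F_k=F_{k-1}+F_{k-2}$. *)

(* Defs.v *)
From HB Require Import structures.
From mathcomp Require Import all_boot all_order all_algebra.

Set Implicit Arguments.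
Unset Strict Implicit.
Unset Printing Implicit Defensive.

Import Order.TTheory GRing.Theory Num.Theory.

(* The vertex set [n] = {1, ..., n} is represented by 'I_n: the ordinal of    *)
(* value k stands for the vertex k + 1.  The condition a_i < i thus reads     *)
(* a i <= i, and it forces the entries below n, so ranging over               *)
(* {ffun 'I_n -> 'I_n} loses no area sequence.                                *)
Definition area_seq n (a : {ffun 'I_n -> 'I_n}) : bool :=
  [forall i : 'I_n, a i <= i]
  && [forall i : 'I_n, forall j : 'I_n, (j == i.+1 :> nat) ==> (a j <= (a i).+1)].

Definition area_graph n (a : {ffun 'I_n -> 'I_n}) : rel 'I_n :=
  fun i j => ((j < i) && (i - a i <= j)) || ((i < j) && (j - a j <= i)).

Definition nbhd n (e : rel 'I_n) (i : 'I_n) : {set 'I_n} := [set j | e i j].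

Definition reduced n (e : rel 'I_n) : bool :=
  ~~ [exists i : 'I_n, exists j : 'I_n,
       [&& j == i.+1 :> nat, e i j & nbhd e i :\ j == nbhd e j :\ i]].

(* The empty graph is not connected. *)
Definition connected n (e : rel 'I_n) : bool :=
  (0 < n) && [forall i, forall j, connect e i j].

Definition isolated n (e : rel 'I_n) (i : 'I_n) : bool := nbhd e i == set0.

(* An isolated vertex i is encoded as the pair (i, i).  Quantifying over the  *)
(* ordinals k of value j + 1 (resp. with k + 1 = i) makes pairs that are not  *)
(* contained in [n] non-edges.                                                *)
Definition peak_edge n (e : rel 'I_n) (p : 'I_n * 'I_n) : bool :=
  let: (i, j) := p in
  ((i == j) && isolated e i)
  || [&& i < j, e i j,
         [forall k : 'I_n, (k == j.+1 :> nat) ==> ~~ e i k]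
       & [forall k : 'I_n, (k.+1 == i :> nat) ==> ~~ e k j]].

Definition peak_cliques n (e : rel 'I_n) : {set {set 'I_n}} :=
  [set [set k : 'I_n | p.1 <= k <= p.2] | p : 'I_n * 'I_n & peak_edge e p].

Definition two_nested n (e : rel 'I_n) : bool :=
  [forall v : 'I_n, #|[set K in peak_cliques e | v \in K]| <= 2].

Definition num_reduced n : nat :=
  #|[set a : {ffun 'I_n -> 'I_n} | area_seq a & reduced (area_graph a)]|.

Definition num_connected_reduced n : nat :=
  #|[set a : {ffun 'I_n -> 'I_n} |
      [&& area_seq a, connected (area_graph a) & reduced (area_graph a)]]|.

Definition num_reduced_two_nested n : nat :=
  #|[set a : {ffun 'I_n -> 'I_n} |
      [&& area_seq a, reduced (area_graph a) & two_nested (area_graph a)]]|.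

Definition num_connected_reduced_two_nested n : nat :=
  #|[set a : {ffun 'I_n -> 'I_n} |
      [&& area_seq a, connected (area_graph a), reduced (area_graph a)
        & two_nested (area_graph a)]]|.

Inductive step := Up | Down | Horizontal.

Definition step_code (s : step) : option bool :=
  match s with Up => Some true | Down => Some false | Horizontal => None end.

Definition step_decode (o : option bool) : step :=
  match o with Some true => Up | Some false => Down | None => Horizontal end.

Lemma step_codeK : cancel step_code step_decode.
Proof. by case. Qed.

HB.instance Definition _ := Finite.copy step (can_type step_codeK).

Definition rise (s : step) : int :=
  match s with Up => 1 | Down => -1 | Horizontal => 0 end%R.

Definition height (w : seq step) : int := (\sum_(s <- w) rise s)%R.

Definition motzkin_path k (w : k.-tuple step) : bool :=
  [forall m : 'I_k.+1, 0 <= height (take m w)]%R && (height w == 0%R).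

Definition motzkin k : nat := #|[set w : k.-tuple step | motzkin_path w]|.

Definition riordan_path k (w : k.-tuple step) : bool :=
  motzkin_path w
  && [forall m : 'I_k,
       ~~ ((tnth w m == Horizontal) && (height (take m w) == 0%R))].

Definition riordan k : nat := #|[set w : k.-tuple step | riordan_path w]|.

Fixpoint fib (k : nat) : nat :=
  match k with
  | 0 => 0
  | k'.+1 => match k' with 0 => 1 | k''.+1 => fib k' + fib k'' end
  end.

(* Main.v *)
(* Let l_i = i - a_i be the leftmost vertex of the closed neighbourhood of i. *)
(* The function l is nondecreasing with l_i <= i, and the graph is reduced    *)
(* iff every i with l_i = l_(i-1) is a value of l.  Reading i = 2, ..., n,    *)
(* write Up when l_i = l_(i-1), otherwise Horizontal when i is a value of l   *)
(* and Down when it is not.  Non-Down steps count values of l and non-Up      *)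
(* steps count jumps of l, so this is a bijection onto Motzkin paths of       *)
(* length n - 1.  The height reached at i is the number of values of l in     *)
(* (l_i, i]; the peak-cliques containing i correspond to the values of l in   *)
(* [l_i, i], so there is one more of them than that height.  A horizontal     *)
(* step at height 0 is exactly an i > 1 with l_i = i, which disconnects the   *)
(* graph.  Hence 2-nested graphs are the paths of height at most 1, and those *)
(* are counted by a two-state transfer recursion.                             *)
Require Import Defs.
From mathcomp Require Import all_boot all_order all_algebra.
From mathcomp Require Import zify.

Set Implicit Arguments.
Unset Strict Implicit.
Unset Printing Implicit Defensive.

(** * Step counts along a path *)

(** Number the vertices 0, ..., m, put [l k = k - a k], and let [w] be the path read off [l]. Then
    [nondowns w k] counts the values of [l] in [1, k] and [nonups w k] counts the jumps of [l] up to
    k. By monotonicity each jump leads to the next value of [l], so [nonups w k] is also the number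
    of values in [1, l k], that is [nondowns w (l k)]. Since [l k] is itself a value, it is the
    first position where [nondowns] attains that number. This is the relation [codes].

    The relation determines [l] from [w] ([codes_inj]) and holds for the path of a reduced bound
    ([bound_path_codes]). Conversely a path that never goes below 0 codes some [l]
    ([path_bound_codes]), and if it ends at height 0 that [l] is a reduced bound whose path is [w]
    again ([codes_bound], [bound_pathK]). This gives the bijection with Motzkin paths.

    Connectedness and 2-nestedness are first expressed through [l] ([connected_area_graphP],
    [two_nested_area_graphP]), then through the path ([codes_cut], [codes_card]), and
    [card_area_path] transfers the counts. For paths of height at most 1, let x and y count
    completions from heights 0 and 1. Then y' = x + y, with x' = x + y if flat steps on the ground
    are allowed (powers of 2) and x' = y if not (Fibonacci numbers). *)

Definition count_before (p : pred step) (w : seq step) (k : nat) : nat :=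
  count p (take k w).

Notation nondowns := (count_before (fun s => s != Down)).
Notation nonups := (count_before (fun s => s != Up)).

Lemma count_before0 p w : count_before p w 0 = 0.
Proof. by rewrite /count_before take0. Qed.

Lemma count_beforeS s0 p w k : k < size w ->
  count_before p w k.+1 = count_before p w k + p (nth s0 w k).
Proof.
by move=> ltkw; rewrite /count_before (take_nth s0) // -cats1 count_cat /= addn0.
Qed.

Lemma count_before_mono p w k k' :
  k <= k' -> k' <= size w -> count_before p w k <= count_before p w k'.
Proof.
move=> /subnKC <-; elim: (k' - k) => [|d IHd]; first by rewrite addn0.
rewrite addnS => lt_w; rewrite (count_beforeS Up) //.
by apply: leq_trans (IHd (ltnW lt_w)) (leq_addr _ _).
Qed.

(** Each step raises the count by at most one, so no level is skipped: the least position at or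
    above level [j] is exactly at [j]. *)
Lemma count_before_reach p w k j : k <= size w -> j <= count_before p w k ->
  exists k', [/\ k' <= k, count_before p w k' = j
               & forall v, v < k' -> count_before p w v < j].
Proof.
move=> le_kw le_j; have ex_k: exists v, j <= count_before p w v by exists k.
exists (ex_minn ex_k); case: ex_minnP => v le_jv minv.
have le_vk: v <= k by apply: minv.
split=> // [|u lt_uv]; last by rewrite ltnNge; apply/negP => /minv; lia.
case: v => [|v] in le_jv minv le_vk *.
  by move: le_jv; rewrite count_before0; lia.
have /(contraNN (minv v)) : ~~ (v.+1 <= v) by lia.
move: le_jv; rewrite (count_beforeS Up) ?(leq_trans le_vk) //=.
by case: (p _) => /=; lia.
Qed.

Lemma height_nil : height [::] = 0%R.
Proof. exact: big_nil. Qed.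

Lemma height_cons s w : height (s :: w) = (rise s + height w)%R.
Proof. by rewrite /height big_cons. Qed.

Lemma height_count w :
  height w = ((count (fun s => s != Down) w)%:Z - (count (fun s => s != Up) w)%:Z)%R.
Proof.
elim: w => [|s w IHw]; first by rewrite height_nil.
by rewrite height_cons IHw; case: s; rewrite /= ?eqxx; lia.
Qed.

Lemma height_take w k : height (take k w) = ((nondowns w k)%:Z - (nonups w k)%:Z)%R.
Proof. exact: height_count. Qed.

Lemma motzkin_pathP k (w : k.-tuple step) :
  reflect ((forall i, i <= k -> nonups w i <= nondowns w i)
           /\ nondowns w k = nonups w k) (motzkin_path w).
Proof.
have htk: height w = ((nondowns w k)%:Z - (nonups w k)%:Z)%R.
  by rewrite -height_take take_oversize ?size_tuple.
apply: (iffP andP) => [[/forallP pos /eqP]|[pos eq_k]].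
  rewrite htk => eq_k; split=> [i le_ik|]; last lia.
  by have := pos (inord i); rewrite inordK // height_take; lia.
split; last by rewrite htk; lia.
by apply/forallP => i; rewrite height_take; have := pos i (ltn_ord i); lia.
Qed.

Lemma bounded_prefixesP k (w : k.-tuple step) :
  reflect (forall i, i <= k -> nondowns w i <= (nonups w i).+1)
    [forall i : 'I_k.+1, height (take i w) <= 1%:Z]%R.
Proof.
apply: (iffP forallP) => le1 i => [le_ik|].
  by have := le1 (inord i); rewrite inordK // height_take; lia.
by rewrite height_take; have := le1 i (ltn_ord i); lia.
Qed.

(* [l] plays the role of i |-> i - a_i, the leftmost element of the closed   *)
(* neighbourhood of i; the last condition is being reduced.                  *)
Record reduced_bound m (l : nat -> nat) : Prop := ReducedBound {
  bound_le : forall k, k <= m -> l k <= k;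
  bound_mono : forall k, k < m -> l k <= l k.+1;
  bound_reduced : forall k, k < m -> l k.+1 = l k -> k.+1 \in mkseq l m.+1 }.

Definition bound_path m (l : nat -> nat) : seq step :=
  mkseq (fun k => if l k.+1 == l k then Up
                  else if k.+1 \in mkseq l m.+1 then Horizontal else Down) m.

(** A relation rather than a function, so that the [l] of a graph and the [path_bound] of a path can
    be compared through [codes_inj]. *)
Definition codes (w : seq step) (l : nat -> nat) : Prop :=
  forall k, k <= size w ->
    [/\ l k <= k, nondowns w (l k) = nonups w k
      & forall v, v < l k -> nondowns w v < nonups w k].

Lemma codes_inj w l l' k : codes w l -> codes w l' -> k <= size w -> l k = l' k.
Proof.
move=> cl cl' le_k; have [_ e m] := cl k le_k; have [_ e' m'] := cl' k le_k.
by case: (ltngtP (l k) (l' k)) => // [/m' | /m]; lia.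
Qed.

Lemma mem_boundP m (l : nat -> nat) v :
  reflect (exists2 j, j <= m & v = l j) (v \in mkseq l m.+1).
Proof.
apply: (iffP mapP) => -[j].
  by rewrite mem_iota => lt_j ->; exists j => //; lia.
by move=> le_jm ->; exists j; rewrite // mem_iota; lia.
Qed.

Lemma leq_homo_below m (l : nat -> nat) i j : (forall k, k < m -> l k <= l k.+1) ->
  i <= j -> j <= m -> l i <= l j.
Proof.
move=> mono /subnKC <-; elim: (j - i) => [|d IHd]; first by rewrite addn0.
by rewrite addnS => lt_m; apply: leq_trans (IHd (ltnW lt_m)) (mono _ lt_m).
Qed.

(** * From a reduced bound to its path *)

Section BoundToPath.
Variables (m : nat) (l : nat -> nat).
Hypothesis lP : reduced_bound m l.
Let w := bound_path m l.

Lemma size_bound_path : size w = m. Proof. exact: size_mkseq. Qed.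

Lemma nondowns_bound_pathS k : k < m ->
  nondowns w k.+1 = nondowns w k + (k.+1 \in mkseq l m.+1).
Proof.
move=> lt_km; rewrite (count_beforeS Up) ?size_bound_path // nth_mkseq //=.
by case: (l k.+1 =P l k) => [/(bound_reduced lP lt_km) -> | _] //; case: (_ \in _).
Qed.

Lemma nonups_bound_pathS k : k < m ->
  nonups w k.+1 = nonups w k + (l k.+1 != l k).
Proof.
move=> lt_km; rewrite (count_beforeS Up) ?size_bound_path // nth_mkseq //=.
by case: (l k.+1 =P l k) => [_ | _] //=; case: (_ \in _).
Qed.

(** Only a step arriving at a value of [l] is counted, so the count is constant across a stretch
    free of values. *)
Lemma nondowns_gap k v : (forall j, j <= m -> l j <= k \/ v < l j) ->
  k <= v -> v <= m -> nondowns w v = nondowns w k.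
Proof.
elim: v => [|v IHv] gap; first by rewrite leqn0 => /eqP ->.
rewrite leq_eqVlt => /predU1P[-> //|lt_kv] lt_vm.
rewrite nondowns_bound_pathS // IHv //; last 2 first.
- by move=> j /gap; lia.
- by lia.
by case: mem_boundP => [[j /gap]|]; lia.
Qed.

Lemma bound_path_codes : codes w l.
Proof.
have lt_jump k : k <= m -> forall v, v < l k -> nondowns w v < nondowns w (l k).
  move=> le_km; have := bound_le lP le_km; case E: (l k) => [//|u] le_uk v le_vu.
  rewrite nondowns_bound_pathS; last lia.
  have -> : u.+1 \in mkseq l m.+1 by apply/mem_boundP; exists k.
  by rewrite addn1 ltnS count_before_mono ?size_bound_path; lia.
suff main k : k <= m -> nondowns w (l k) = nonups w k.
  move=> k; rewrite size_bound_path => le_km; split; first exact: bound_le lP _ _.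
    exact: main.
  by move=> v; rewrite -main //; apply: lt_jump.
elim: k => [|k IHk] lt_km.
  by have := bound_le lP lt_km; rewrite leqn0 => /eqP ->; rewrite !count_before0.
rewrite nonups_bound_pathS // -IHk; last exact: ltnW.
case: eqP => [-> | neq_l] /=; first by rewrite addn0.
(* At a jump nothing strictly between [l k] and [l k.+1] is a value of [l], so [nondowns] grows by
   exactly one between them, as [nonups] does. *)
have lt_l: l k < l k.+1 by have := bound_mono lP lt_km; lia.
have le_lk := bound_le lP lt_km.
have inim: l k.+1 \in mkseq l m.+1 by apply/mem_boundP; exists k.+1.
case E: (l k.+1) => [|u]; first lia.
rewrite nondowns_bound_pathS -?E; last lia.
rewrite inim (@nondowns_gap (l k) u) //; try lia.
move=> j le_jm; case: (leqP j k) => [le_jk | lt_kj].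
  by left; apply: leq_homo_below (bound_mono lP) _ _ => //; lia.
by right; rewrite -ltnS -E ltnS; apply: leq_homo_below (bound_mono lP) _ _.
Qed.

Lemma bound_path_motzkin :
  (forall i, i <= m -> nonups w i <= nondowns w i) /\ nondowns w m = nonups w m.
Proof.
split=> [i le_im|].
  have [|le_l <- _] := bound_path_codes (k := i); first by rewrite size_bound_path.
  by rewrite count_before_mono // size_bound_path.
have [|le_l <- _] := bound_path_codes (k := m); first by rewrite size_bound_path.
(* No value of [l] exceeds [l m], so the count no longer changes after [l m]. *)
apply: nondowns_gap => // j le_jm; left.
exact: leq_homo_below (bound_mono lP) _ _.
Qed.

End BoundToPath.

(** * From a path back to a bound *)

Section PathToBound.
Variables (m : nat) (w : seq step).
Hypothesis size_w : size w = m.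

Definition path_bound (w : seq step) (k : nat) : nat :=
  find (fun v => nonups w k <= nondowns w v) (iota 0 (size w).+1).

Lemma path_bound_codes :
  (forall i, i <= m -> nonups w i <= nondowns w i) -> codes w (path_bound w).
Proof.
move=> pos k le_k; rewrite size_w in le_k.
have [|v [le_vk eq_v minv]] := count_before_reach _ (pos k le_k); first by rewrite size_w.
suff -> : path_bound w k = v by [].
(* Split the search range at [v]: the test fails before [v] by minimality and succeeds at [v]. *)
rewrite /path_bound; have -> : (size w).+1 = v + (size w - v).+1 by lia.
rewrite iotaD find_cat ifN.
  by rewrite size_iota /= add0n eq_v leqnn addn0.
apply/hasPn => u; rewrite mem_iota /= add0n -ltnNge; exact: minv.
Qed.

Variable l : nat -> nat.
Hypothesis wl : codes w l.
Hypothesis w_end : nondowns w m = nonups w m.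

Lemma codes_mem k : k < m -> (k.+1 \in mkseq l m.+1) = (nth Up w k != Down).
Proof.
move=> lt_km.
have nd: nondowns w k.+1 = nondowns w k + (nth Up w k != Down).
  by rewrite (count_beforeS Up) // size_w.
apply/mem_boundP/idP => [[j le_jm e]|ndk].
  have [|_ ej /(_ k)] := wl (k := j); first by rewrite size_w.
  rewrite -e => /(_ (ltnSn k)); rewrite -ej -e nd.
  by case: (_ != _) => //; rewrite addn0 ltnn.
rewrite ndk in nd.
(* Both counts end at the same total, so [nonups] attains the level [nondowns w k.+1] at some [j].
   That level is first reached by [nondowns] at [k.+1], hence [l j = k.+1]. *)
have [||j [le_jm ej _]] := @count_before_reach (fun s => s != Up) w m (nondowns w k.+1).
- by rewrite size_w.
- by rewrite -w_end count_before_mono // size_w.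
exists j => //; have [|le_lj elj minj] := wl (k := j); first by rewrite size_w.
apply/eqP; case: (ltngtP (l j) k.+1) => // lt.
  have : nondowns w (l j) <= nondowns w k.
    by apply: count_before_mono; rewrite ?size_w // ltnW.
  by rewrite elj ej nd addn1 ltnn.
by have := minj _ lt; rewrite ej ltnn.
Qed.

Lemma codes_up k : k < m -> (l k.+1 == l k) = (nth Up w k == Up).
Proof.
move=> lt_km.
have nu: nonups w k.+1 = nonups w k + (nth Up w k != Up).
  by rewrite (count_beforeS Up) // size_w.
have [|_ e m1] := wl (k := k); first by rewrite size_w ltnW.
have [|_ e' m2] := wl (k := k.+1); first by rewrite size_w.
apply/idP/idP => [/eqP E|up].
  by rewrite E in e'; move: nu; case: (_ == Up) => //= nu; exfalso; lia.
rewrite up addn0 in nu.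
by apply/eqP; case: (ltngtP (l k.+1) (l k)) => // [/m1|/m2]; lia.
Qed.

Lemma codes_bound : reduced_bound m l.
Proof.
split=> k lt_km.
- by case: (wl (k := k)); rewrite ?size_w.
- have nu: nonups w k <= nonups w k.+1 by rewrite count_before_mono // size_w.
  have [|_ e m1] := wl (k := k); first by rewrite size_w ltnW.
  have [|_ e' m2] := wl (k := k.+1); first by rewrite size_w.
  by rewrite leqNgt; apply/negP => /m1; lia.
- by move/eqP; rewrite codes_up // codes_mem // => /eqP ->.
Qed.

Lemma bound_pathK : bound_path m l = w.
Proof.
apply: (@eq_from_nth _ Up) => [|k]; rewrite size_bound_path // => lt_km.
rewrite nth_mkseq // codes_up // codes_mem //.
by case: (nth Up w k).
Qed.

Lemma codes_cut k : k < m -> nonups w k <= nondowns w k ->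
  (l k.+1 == k.+1) = (nth Up w k == Horizontal) && (nondowns w k == nonups w k).
Proof.
move=> lt_km pos_k.
have lt_kw: k < size w by rewrite size_w.
have nu := count_beforeS Up (fun s => s != Up) lt_kw.
have nd := count_beforeS Up (fun s => s != Down) lt_kw.
have [le_l e minl] := wl lt_kw.
apply/idP/idP => [/eqP E|/andP[/eqP wk /eqP h0]].
  rewrite E in e minl; have := minl k.
  by case: (nth Up w k) nu nd => //=; lia.
rewrite wk /= in nu nd; rewrite eqn_leq le_l leqNgt /=; apply/negP => lt.
have : nondowns w (l k.+1) <= nondowns w k.
  by apply: count_before_mono; rewrite // ltnW.
by rewrite e nu h0 addn1 ltnn.
Qed.

(** The values of [l] in (l v, v] number the height at [v]; the value [l v] itself adds one. *)
Lemma codes_card v : v <= m ->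
  #|[set i : 'I_m.+1 | (l v <= i <= v) && ((i : nat) \in mkseq l m.+1)]|
  + nonups w v = (nondowns w v).+1.
Proof.
move=> le_vm; have [|le_lv <- _] := wl (k := v); first by rewrite size_w.
have inl: l v \in mkseq l m.+1 by apply/mem_boundP; exists v.
(* Only the fact that [l v] is a value matters; replacing it by a fixed value [u] allows induction
   on [v]. *)
move: (l v) le_lv inl => u; elim: v le_vm => [|v IHv] lt_vm le_uv inu.
  have {inu le_uv}[u0 in0]: u = 0 /\ 0 \in mkseq l m.+1.
    by move: inu; have -> : u = 0 by lia.
  rewrite u0 count_before0 addn0 (_ : [set _ | _] = [set ord0]) ?cards1 //.
  apply/setP => i; rewrite in_set in_set1; apply/andP/eqP => [[]|->] //.
  by move=> ? _; apply: val_inj => /=; lia.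
have nd: nondowns w v.+1 = nondowns w v + (v.+1 \in mkseq l m.+1).
  by rewrite codes_mem // (count_beforeS Up) // size_w.
move: le_uv; rewrite leq_eqVlt => /predU1P[eu|lt_uv].
  rewrite eu in inu *.
  rewrite (_ : [set _ | _] = [set (inord v.+1 : 'I_m.+1)]) ?cards1 //.
  apply/setP => i; rewrite in_set in_set1; apply/andP/eqP => [[]|->].
    by move=> ? _; apply: val_inj; rewrite /= inordK //; lia.
  by rewrite inordK // leqnn.
have {IHv} := IHv (ltnW lt_vm) lt_uv inu.
rewrite nd; case: (boolP (v.+1 \in _)) => [inv|ninv] IH.
  rewrite (_ : [set _ | _] = (inord v.+1 : 'I_m.+1) |:
      [set i : 'I_m.+1 | (u <= i <= v) && ((i : nat) \in mkseq l m.+1)]).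
    by rewrite cardsU1 in_set inordK // ltnn andbF -addnA IH addn1.
  apply/setP => i; rewrite in_setU1 !in_set.
  case: (i =P _) => [->|ne]; rewrite ?orTb ?orFb.
    by rewrite inordK // inv andbT; lia.
  congr (_ && _); have: (i : nat) <> v.+1.
    by move=> ei; apply: ne; apply: val_inj; rewrite /= inordK.
  by lia.
rewrite (_ : [set _ | _] =
      [set i : 'I_m.+1 | (u <= i <= v) && ((i : nat) \in mkseq l m.+1)]); first lia.
apply/setP => i; rewrite !in_set; case: (boolP (_ \in _)) => [ini|]; last by rewrite !andbF.
rewrite !andbT; have: (i : nat) <> v.+1 by move=> ei; rewrite -ei ini in ninv.
by lia.
Qed.

End PathToBound.

(** * Area graphs *)

Definition left_end m (a : {ffun 'I_m.+1 -> 'I_m.+1}) (k : nat) : nat :=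
  k - a (inord k).

Section AreaGraph.
Variables (m : nat) (a : {ffun 'I_m.+1 -> 'I_m.+1}).
Let e := area_graph a.
Let l := left_end a.

Lemma area_graphE (i j : 'I_m.+1) :
  e i j = ((j < i) && (l i <= j)) || ((i < j) && (l j <= i)).
Proof. by rewrite /e /l /area_graph /left_end !inord_val. Qed.

(** In terms of [l k = k - a k], the growth condition on area sequences is monotonicity. *)
Lemma area_seqP :
  reflect ((forall i : 'I_m.+1, a i <= i) /\ forall k, k < m -> l k <= l k.+1)
    (area_seq a).
Proof.
apply: (iffP andP) => -[/= Ha].
  move=> /forallP Hs; split=> [i|k lt_km]; first by have /forallP := Ha.
  have /forallP/(_ (inord k.+1)) := Hs (inord k).
  rewrite !inordK ?eqxx /=; try lia.
  by rewrite /l /left_end; lia.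
move=> Hs; split; first by apply/forallP.
apply/forallP => i; apply/forallP => j; apply/implyP => /eqP e_ij.
have lt_im: i < m by have := ltn_ord j; lia.
have := Hs i lt_im; rewrite /l /left_end -e_ij !inord_val.
by have := Ha i; have := Ha j; lia.
Qed.

Hypothesis area_a : area_seq a.

Lemma left_end_le k : l k <= k. Proof. exact: leq_subr. Qed.

Lemma left_endS k : k < m -> l k <= l k.+1.
Proof. by have /area_seqP[_] := area_a; apply. Qed.

Lemma left_end_mono i j : i <= j -> j <= m -> l i <= l j.
Proof. exact: leq_homo_below left_endS. Qed.

Lemma left_end_mono_ord (i j : 'I_m.+1) : i <= j -> l i <= l j.
Proof. by move=> le_ij; apply: left_end_mono; rewrite // -ltnS. Qed.

Lemma mem_left_endP v :
  reflect (exists j : 'I_m.+1, v = l j) (v \in mkseq l m.+1).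
Proof.
apply: (iffP (mem_boundP _ _ _)) => [[j le_jm ->]|[j ->]].
  by exists (inord j); rewrite inordK.
by exists j; rewrite // -ltnS.
Qed.

(** The vertices k and k + 1 have the same left neighbours when [l] agrees on them; on the right
    they are told apart exactly by a vertex [x] with [l x = k.+1]. *)
Lemma reduced_area_graphP :
  reflect (forall k, k < m -> l k.+1 = l k -> k.+1 \in mkseq l m.+1) (reduced e).
Proof.
apply: (iffP idP) => [red k lt_km eq_l|red].
  apply: contraNT red => nk1; apply/existsP; exists (inord k).
  apply/existsP; exists (inord k.+1); set i := inord k; set j := inord k.+1.
  have ei: i = k :> nat by rewrite inordK //; lia.
  have ej: j = k.+1 :> nat by rewrite inordK.
  have le_lk := left_end_le k.
  rewrite ei ej eqxx area_graphE ei ej eq_l le_lk ltnSn orbT /=.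
  apply/eqP/setP => x; rewrite !in_setD1 !inE -!(inj_eq val_inj) /= !area_graphE.
  have : l x <> k.+1 by move=> lx; case/mem_left_endP: nk1; exists x.
  by rewrite ei ej eq_l; lia.
apply/negP => /existsP[i /existsP[j /and3P[/eqP eij]]].
rewrite area_graphE => e_ij /eqP/setP same.
have {}same (x : 'I_m.+1) : (x != j :> nat) && e i x = (x != i :> nat) && e j x.
  by have := same x; rewrite !in_setD1 !inE -!(inj_eq val_inj).
have lt_im: i < m by have := ltn_ord j; lia.
have le_ij := left_endS lt_im; have le_i := left_end_le i.
rewrite -eij in le_ij.
have eq_l: l j = l i.
  (* If [l i < l j], the vertex [l i] would separate [i] from [j]. *)
  have := same (inord (l i)); rewrite !area_graphE inordK; last lia.
  by lia.
(* A vertex [x] with [l x = j] is adjacent to [j] but not to [i]. *)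
rewrite eij in eq_l; have /mem_left_endP[x lx] := red i lt_im eq_l.
rewrite -eij in eq_l lx.
have := same x; rewrite !area_graphE; have := left_end_le x.
have : x <> j :> nat by move=> ex; rewrite ex in lx; lia.
by lia.
Qed.

Lemma area_graph_sym : symmetric e.
Proof. by move=> i j; rewrite !area_graphE orbC. Qed.

(** If [l k.+1 = k.+1], monotonicity forbids any edge across the gap between k and k + 1. Otherwise
    all consecutive vertices are adjacent. *)
Lemma connected_area_graphP :
  reflect (forall k, k < m -> l k.+1 != k.+1) (connected e).
Proof.
apply: (iffP idP) => [/forallP conn k lt_km|cut].
  apply/negP => /eqP cut.
  have /forallP/(_ (inord k.+1)) := conn ord0.
  have cl: closed e [pred i : 'I_m.+1 | i <= k].
    move=> i j; rewrite area_graphE !inE => e_ij.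
    have lej (i' j' : 'I_m.+1) : l j' <= i' -> i' <= k -> j' <= k.
      move=> le_l le_i; rewrite leqNgt; apply/negP => lt.
      by have := @left_end_mono k.+1 j' lt; rewrite -ltnS ltn_ord => /(_ isT); lia.
    by have := lej i j; have := lej j i; lia.
  by move/(closed_connect cl); rewrite !inE inordK // ltnn.
have conn0 k : k <= m -> connect e ord0 (inord k).
  elim: k => [_|k IHk lt_km].
    by have -> : inord 0 = ord0 :> 'I_m.+1 by apply: val_inj; rewrite /= inordK.
  apply: connect_trans (IHk (ltnW lt_km)) (connect1 _).
  have := cut k lt_km; have := left_end_le k.+1.
  by rewrite area_graphE !inordK //; lia.
apply/forallP => i; apply/forallP => j.
have e0 (x : 'I_m.+1) : connect e ord0 x.
  by rewrite -(inord_val x); apply: conn0; rewrite -ltnS.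
apply: connect_trans (e0 j); rewrite (sym_connect_sym area_graph_sym); exact: e0.
Qed.

(** One formula covers genuine edges and isolated vertices, the latter being the case [i = j]. *)
Lemma peak_edgeE (i j : 'I_m.+1) :
  peak_edge e (i, j) =
    (l j == i) && [forall k : 'I_m.+1, (k == j.+1 :> nat) ==> (i < l k)].
Proof.
apply/orP/andP => [|[/eqP lj /forallP lt_l]].
  case=> [/andP[/eqP <- /eqP/setP iso]|/and4P[lt_ij e_ij /forallP nr /forallP nl]].
    have {}iso x : e i x = false by have := iso x; rewrite !inE.
    split; last first.
      apply/forallP => k; apply/implyP => /eqP ek.
      by have := iso k; rewrite area_graphE; lia.
    have := iso (inord (l i)); have := left_end_le i; have := ltn_ord i => lt le.
    by rewrite area_graphE inordK; lia.
  split; last first.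
    apply/forallP => k; apply/implyP => ek; have := nr k; rewrite ek area_graphE.
    by lia.
  rewrite area_graphE in e_ij; have := ltn_ord i => lt.
  case: (posnP i) => [i0|i_gt0]; first lia.
  have := nl (inord i.-1); rewrite area_graphE inordK ?prednK ?eqxx /=; lia.
have le_j := left_end_le j.
case: (eqVneq i j) => [eij|neq_ij] /=; [left; rewrite -eij in lj lt_l|right].
  apply/eqP/setP => x; rewrite !inE area_graphE; apply/negP => e_ix.
  have lt_ix: i < x by move: e_ix; rewrite lj; lia.
  have := lt_l (inord i.+1); have := ltn_ord x => lt_x.
  rewrite inordK ?eqxx /=; last lia.
  have := @left_end_mono i.+1 x lt_ix; lia.
have lt_ij: i < j by move: neq_ij; rewrite -(inj_eq val_inj) /=; lia.
rewrite lt_ij area_graphE lt_ij lj leqnn orbT /=; apply/andP; split.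
  apply/forallP => k; apply/implyP => ek; have := lt_l k; rewrite ek area_graphE /=.
  by lia.
by apply/forallP => k; apply/implyP => ek; rewrite area_graphE; lia.
Qed.

(** The vertex [i] with its right neighbours: a form of the peak-clique that depends on its left end
    only. *)
Definition clique_from (i : 'I_m.+1) : {set 'I_m.+1} :=
  [set k : 'I_m.+1 | (i <= k) && (l k <= i)].

Lemma peak_edge_clique (i j : 'I_m.+1) : peak_edge e (i, j) ->
  [set k : 'I_m.+1 | i <= k <= j] = clique_from i.
Proof.
rewrite peak_edgeE => /andP[/eqP lj /forallP lt_l].
apply/setP => k; rewrite !in_set; case: (leqP k j) => [le_kj|lt_jk].
  by have := left_end_mono_ord le_kj; lia.
have := lt_l (inord j.+1); have := ltn_ord k => lt_k.
rewrite inordK ?eqxx /=; last lia.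
by have := @left_end_mono j.+1 k lt_jk; lia.
Qed.

Lemma peak_cliquesE :
  peak_cliques e = clique_from @: [set i : 'I_m.+1 | (i : nat) \in mkseq l m.+1].
Proof.
apply/setP => K; apply/imsetP/imsetP => [[[i j]]|[i]].
  rewrite inE => pij ->; exists i; last exact: peak_edge_clique.
  rewrite in_set; move: pij; rewrite peak_edgeE => /andP[/eqP lj _].
  by apply/mem_left_endP; exists j.
rewrite in_set => /mem_left_endP[j0 lj0] ->.
have Pj0: l j0 == i by rewrite -lj0.
(* The right end of the peak-edge at [i] is the last vertex [j] with [l j = i]. *)
case: (@arg_maxnP _ j0 (fun j : 'I_m.+1 => l j == i) (@nat_of_ord _) Pj0) => j /eqP lj maxj.
have pij: peak_edge e (i, j).
  rewrite peak_edgeE lj eqxx; apply/forallP => k; apply/implyP => /eqP ek.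
  have := @left_end_mono_ord j k; have := maxj k; lia.
by exists (i, j); rewrite ?inE //= peak_edge_clique.
Qed.

Lemma two_nested_area_graphP :
  reflect (forall v, v <= m ->
             #|[set i : 'I_m.+1 | (l v <= i <= v) && ((i : nat) \in mkseq l m.+1)]| <= 2)
    (two_nested e).
Proof.
have cardE (v : 'I_m.+1) : #|[set K in peak_cliques e | v \in K]| =
    #|[set i : 'I_m.+1 | (l v <= i <= v) && ((i : nat) \in mkseq l m.+1)]|.
  (* The least element of [clique_from i] is [i], so counting cliques through [v] amounts to
     counting their left ends, the values of [l] in [l v, v]. *)
  have injK: {in [set i : 'I_m.+1 | (l v <= i <= v) && ((i : nat) \in mkseq l m.+1)] &,
               injective clique_from}.
    move=> i j _ _ eqK; have := left_end_le i; have := left_end_le j.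
    have /setP/(_ i) := eqK; have /setP/(_ j) := eqK; rewrite !in_set !leqnn /=.
    by move=> *; apply: val_inj => /=; lia.
  rewrite -(card_in_imset injK); congr #|pred_of_set _|.
  apply/setP => K; rewrite in_set peak_cliquesE; apply/andP/imsetP.
    case=> /imsetP[i]; rewrite in_set => imi ->; rewrite in_set => vi.
    by exists i; rewrite // in_set imi andbT andbC.
  case=> i; rewrite in_set => /andP[vi imi] ->; rewrite in_set andbC; split=> //.
  by apply/imsetP; exists i; rewrite // in_set.
apply: (iffP forallP) => [le2 v le_vm | le2 v]; last first.
  by rewrite cardE; apply: le2; rewrite -ltnS.
by have := le2 (inord v); rewrite cardE inordK.
Qed.

End AreaGraph.

(** * The bijection with Motzkin paths *)

Definition area_path m (a : {ffun 'I_m.+1 -> 'I_m.+1}) : m.-tuple step :=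
  Tuple (introT eqP (size_bound_path m (left_end a))).

Definition path_area m (w : m.-tuple step) : {ffun 'I_m.+1 -> 'I_m.+1} :=
  [ffun i : 'I_m.+1 => inord (i - path_bound w i)].

Section Correspondence.
Variable m : nat.
Implicit Types (a : {ffun 'I_m.+1 -> 'I_m.+1}) (w : m.-tuple step).

Lemma area_reduced_bound a :
  area_seq a && reduced (area_graph a) -> reduced_bound m (left_end a).
Proof.
case/andP=> area_a /(reduced_area_graphP area_a) red_a; split=> // k lt_km.
  exact: left_end_le.
exact: left_endS.
Qed.

Lemma area_path_codes a : area_seq a && reduced (area_graph a) ->
  codes (area_path a) (left_end a).
Proof. by move=> /area_reduced_bound; apply: bound_path_codes. Qed.

Lemma area_path_motzkin a : area_seq a && reduced (area_graph a) ->
  motzkin_path (area_path a).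
Proof.
by move=> /area_reduced_bound Xa; apply/motzkin_pathP; apply: bound_path_motzkin.
Qed.

Lemma area_pathK a : area_seq a && reduced (area_graph a) ->
  path_area (area_path a) = a.
Proof.
move=> Xa; have /motzkin_pathP[pos _] := area_path_motzkin Xa.
have cw := path_bound_codes (size_tuple (area_path a)) pos.
apply/ffunP => i; apply: val_inj; rewrite ffunE /=.
have le_i : i <= size (area_path a) by rewrite size_tuple -ltnS.
rewrite (codes_inj cw (area_path_codes Xa) le_i) /left_end inord_val.
have /andP[/area_seqP[le_a _] _] := Xa.
by rewrite subKn ?inord_val.
Qed.

Lemma path_area_codes w : motzkin_path w -> codes w (left_end (path_area w)).
Proof.
case/motzkin_pathP => pos _ k le_k; have cw := path_bound_codes (size_tuple w) pos.
suff -> : left_end (path_area w) k = path_bound w k by apply: cw.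
have [le_b _ _] := cw k le_k; rewrite size_tuple in le_k.
by rewrite /left_end ffunE !inordK; lia.
Qed.

Lemma path_area_reduced w : motzkin_path w ->
  area_seq (path_area w) && reduced (area_graph (path_area w)).
Proof.
move=> mw; have cw := path_area_codes mw.
have /motzkin_pathP[pos w_end] := mw.
have [_ mono red] := codes_bound (size_tuple w) cw w_end.
have area_w : area_seq (path_area w).
  apply/area_seqP; split=> // i; have := ltn_ord i => lt_i.
  by rewrite ffunE inordK ?leq_subr //; lia.
by rewrite area_w; apply/reduced_area_graphP.
Qed.

Lemma path_areaK w : motzkin_path w -> area_path (path_area w) = w.
Proof.
move=> mw; have /motzkin_pathP[_ w_end] := mw; apply: val_inj.
exact: (bound_pathK (size_tuple w) (path_area_codes mw) w_end).
Qed.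

(** The bijection with an arbitrary extra property carried along, so that every count in the theorem
    is an instance. *)
Lemma card_area_path (Q : pred {ffun 'I_m.+1 -> 'I_m.+1}) (Q' : pred (m.-tuple step)) :
  (forall a, area_seq a && reduced (area_graph a) -> Q a = Q' (area_path a)) ->
  #|[set a | (area_seq a && reduced (area_graph a)) && Q a]|
  = #|[set w : m.-tuple step | motzkin_path w && Q' w]|.
Proof.
move=> QQ'; rewrite -(@card_in_imset _ _ (@area_path m)).
  congr #|pred_of_set _|; apply/setP => w; rewrite inE.
  apply/imsetP/andP => [[a]|[mw Qw]].
    by rewrite inE => /andP[Xa Qa] ->; rewrite -QQ' // area_path_motzkin.
  exists (path_area w); last by rewrite path_areaK.
  by rewrite inE path_area_reduced // QQ' ?path_areaK // path_area_reduced.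
move=> a b; rewrite !inE => /andP[Xa _] /andP[Xb _] eq_path.
by rewrite -(area_pathK Xa) eq_path area_pathK.
Qed.

Lemma connected_area_path a : area_seq a && reduced (area_graph a) ->
  connected (area_graph a) =
  [forall i : 'I_m, ~~ ((tnth (area_path a) i == Horizontal)
                        && (height (take i (area_path a)) == 0%R))].
Proof.
move=> Xa; have /andP[area_a _] := Xa.
have cw := area_path_codes Xa.
have /motzkin_pathP[pos w_end] := area_path_motzkin Xa.
have cut k : k < m -> (left_end a k.+1 == k.+1) =
    (nth Up (area_path a) k == Horizontal) && (height (take k (area_path a)) == 0%R).
  move=> lt_km; rewrite (codes_cut (size_tuple _) cw) ?pos ?(ltnW lt_km) //.
  by rewrite height_take; congr (_ && _); lia.
apply/connected_area_graphP/forallP => // [nocut i|nocut k lt_km].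
  by rewrite (tnth_nth Up) -cut // nocut.
by rewrite cut // -(tnth_nth Up _ (Ordinal lt_km)) nocut.
Qed.

Lemma two_nested_area_path a : area_seq a && reduced (area_graph a) ->
  two_nested (area_graph a) =
  [forall i : 'I_m.+1, height (take i (area_path a)) <= 1%:Z]%R.
Proof.
move=> Xa; have /andP[area_a _] := Xa.
have cw := area_path_codes Xa.
have /motzkin_pathP[pos w_end] := area_path_motzkin Xa.
apply/two_nested_area_graphP/bounded_prefixesP => // le2 v le_vm.
  have := codes_card (size_tuple _) cw w_end le_vm; have := le2 v le_vm; lia.
have := codes_card (size_tuple _) cw w_end le_vm; have := le2 v le_vm; lia.
Qed.

End Correspondence.

(** * Graph counts as path counts *)

Lemma num_reducedS m : num_reduced m.+1 = motzkin m.
Proof.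
rewrite /num_reduced /motzkin.
have := @card_area_path m xpredT xpredT (fun _ _ => erefl).
by under eq_finset do rewrite andbT; under [in RHS]eq_finset do rewrite andbT.
Qed.

Lemma num_connected_reducedS m : num_connected_reduced m.+1 = riordan m.
Proof.
rewrite /riordan /riordan_path -(card_area_path (@connected_area_path m)).
by apply: eq_card => a; rewrite !inE; case: (connected _); rewrite ?andbT ?andbF.
Qed.

Definition low_path k (w : k.-tuple step) : bool :=
  motzkin_path w && [forall i : 'I_k.+1, height (take i w) <= 1%:Z]%R.

Definition low_riordan_path k (w : k.-tuple step) : bool :=
  riordan_path w && [forall i : 'I_k.+1, height (take i w) <= 1%:Z]%R.

Lemma num_reduced_two_nestedS m :
  num_reduced_two_nested m.+1 = #|[set w : m.-tuple step | low_path w]|.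
Proof.
rewrite /low_path -(card_area_path (@two_nested_area_path m)).
by apply: eq_card => a; rewrite !inE andbA.
Qed.

Lemma num_connected_reduced_two_nestedS m :
  num_connected_reduced_two_nested m.+1 =
  #|[set w : m.-tuple step | low_riordan_path w]|.
Proof.
pose Q (a : {ffun 'I_m.+1 -> 'I_m.+1}) :=
  connected (area_graph a) && two_nested (area_graph a).
pose Q' (w : m.-tuple step) :=
  [forall i : 'I_m, ~~ ((tnth w i == Horizontal) && (height (take i w) == 0%R))]
  && [forall i : 'I_m.+1, height (take i w) <= 1%:Z]%R.
transitivity #|[set w : m.-tuple step | motzkin_path w && Q' w]|.
  rewrite -(@card_area_path m Q Q') => [|a Xa].
    by apply: eq_card => a; rewrite !inE /Q -andbA; congr (_ && _); rewrite andbCA.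
  by rewrite /Q connected_area_path // two_nested_area_path.
by apply: eq_card => w; rewrite !inE /Q' /low_riordan_path /riordan_path andbA.
Qed.

(** * Paths of height at most one *)

Lemma sum_step (F : step -> nat) : \sum_s F s = F Up + F Down + F Horizontal.
Proof.
rewrite (bigD1 Up) // (bigD1 Down) // (bigD1 Horizontal) //= big_pred0 => [|[]] //.
by rewrite addn0 addnA.
Qed.

Lemma card_tupleS (T : finType) k (P : pred (seq T)) :
  #|[set w : k.+1.-tuple T | P w]| = \sum_s #|[set w : k.-tuple T | P (s :: w)]|.
Proof.
rewrite -sum1dep_card; under [RHS]eq_bigr do rewrite -sum1dep_card.
rewrite pair_big_dep /= (reindex (fun u : T * k.-tuple T => [tuple of u.1 :: u.2])) //=.
exists (fun w : k.+1.-tuple T => (thead w, [tuple of behead w])) => [[s w] _|w _] /=.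
  by congr (_, _); apply: val_inj.
by rewrite [RHS]tuple_eta.
Qed.

(* Acceptor for paths confined to heights 0 and 1, started at height 1 when  *)
(* [up] holds; horizontal steps at height 0 are accepted when [flat] holds.  *)
Fixpoint low_from (flat up : bool) (w : seq step) : bool :=
  if w is s :: w' then
    match s with
    | Up => ~~ up && low_from flat true w'
    | Down => up && low_from flat false w'
    | Horizontal => (up || flat) && low_from flat up w'
    end
  else ~~ up.

Definition num_low flat up k : nat := #|[set w : k.-tuple step | low_from flat up w]|.

Lemma num_low0 flat up : num_low flat up 0 = ~~ up.
Proof.
rewrite /num_low; case: up => /=.
  by rewrite eq_card0 // => w; rewrite inE tuple0.
rewrite (_ : [set w : 0.-tuple step | _] = setT) ?cardsT ?card_tuple //.
by apply/setP => w; rewrite !inE tuple0.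
Qed.

Lemma num_low_upS flat k :
  num_low flat true k.+1 = num_low flat false k + num_low flat true k.
Proof.
rewrite /num_low (card_tupleS _ (low_from flat true)) sum_step /=.
by rewrite [X in X + _ + _]eq_card0 // => w; rewrite inE.
Qed.

Lemma num_low_groundS flat k :
  num_low flat false k.+1 = num_low flat true k + flat * num_low flat false k.
Proof.
rewrite /num_low (card_tupleS _ (low_from flat false)) sum_step /=.
rewrite [X in _ + X + _]eq_card0 ?addn0; last by move=> w; rewrite inE.
congr (_ + _); case: flat; rewrite ?mul1n // mul0n.
by rewrite eq_card0 // => w; rewrite inE.
Qed.

(** After one step both states satisfy the same recursion, the sum of the two, so both double
    together. *)
Lemma num_low_flat k :
  num_low true false k.+1 = 2 ^ k /\ num_low true true k.+1 = 2 ^ k.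
Proof.
elim: k => [|k [IH0 IH1]]; first by rewrite num_low_upS num_low_groundS !num_low0.
by rewrite num_low_upS num_low_groundS IH0 IH1 mul1n addnn -mul2n -expnS.
Qed.

Lemma num_low_noflat k :
  num_low false false k.+1 = fib k /\ num_low false true k.+1 = fib k.+1.
Proof.
elim: k => [|k [IH0 IH1]]; first by rewrite num_low_upS num_low_groundS !num_low0.
by rewrite num_low_upS num_low_groundS IH0 IH1 mul0n addn0 addnC.
Qed.

Lemma low_fromP flat (up : bool) w :
  reflect
    [/\ forall i, i <= size w -> (0 <= up%:Z + height (take i w) <= 1)%R,
        (up%:Z + height w = 0)%R
      & forall i, i < size w -> nth Up w i = Horizontal ->
          flat || (up%:Z + height (take i w) != 0)%R]
    (low_from flat up w).
Proof.
elim: w up => [|s w IHw] up.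
  apply: (iffP idP) => /= [/negbTE -> | [_ h0 _]].
    by split=> [i _||//]; rewrite height_nil.
  by move: h0; rewrite height_nil; case: up.
have hS (u : bool) v : (up%:Z + rise s = u%:Z)%R ->
  (up%:Z + height (s :: v) = u%:Z + height v)%R by rewrite height_cons; lia.
apply: (iffP idP) => [|[bnd e nh]].
  move=> Hw; have {Hw}[u eu [Hf /IHw[bnd e nh]]] : exists2 u : bool,
      (up%:Z + rise s = u%:Z)%R &
      (s = Horizontal -> flat || up) /\ low_from flat u w.
    case: s Hw {hS} => /= /andP[h1 h2];
      [exists true | exists false | exists up] => //; first 2 last.
    - by rewrite /=; lia.
    - by split=> // _; rewrite orbC.
    - by case: up h1.
    - by case: up h1.
  split=> [[|i]||[|i]] /=.
  - by rewrite height_nil; case: (up).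
  - by rewrite ltnS (hS _ _ eu); apply: bnd.
  - by rewrite (hS _ _ eu).
  - by move=> _ /Hf; rewrite height_nil; case: (up).
  - by rewrite ltnS (hS _ _ eu); apply: nh.
(* The height after the first step is again 0 or 1, by the bound at position 1; it is the state
   passed to the tail. *)
have [u eu] : exists u : bool, (up%:Z + rise s = u%:Z)%R.
  have := bnd 1 isT; rewrite /= take0 height_cons height_nil.
  exists (up%:Z + rise s == 1)%R; lia.
have : low_from flat u w.
  apply/IHw; split=> [i le_i||i lt_i hi].
  - by rewrite -(hS _ _ eu); apply: (bnd i.+1).
  - by rewrite -(hS _ _ eu).
  - by rewrite -(hS _ _ eu); apply: (nh i.+1).
have := nh 0 isT; rewrite /= height_nil.
by case: s up u eu {bnd e nh hS IHw} => -[] [] //= _ /(_ erefl); rewrite ?orbF => ->.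
Qed.

Lemma low_pathE k (w : k.-tuple step) : low_path w = low_from true false w.
Proof.
apply/andP/low_fromP => [[/andP[/forallP ge0 /eqP h0] /forallP le1]|[bnd h0 _]].
  rewrite size_tuple; split=> // [i le_i|]; last by rewrite GRing.add0r.
  by have := ge0 (inord i); have := le1 (inord i); rewrite inordK // GRing.add0r => -> ->.
rewrite size_tuple in bnd.
have {}bnd (i : 'I_k.+1) : (0 <= height (take i w) <= 1)%R.
  by have := bnd i (ltn_ord i); rewrite GRing.add0r.
rewrite /motzkin_path -[height w]GRing.add0r h0 eqxx andbT.
by split; apply/forallP => i; have /andP[] := bnd i.
Qed.

Lemma low_riordan_pathE k (w : k.-tuple step) :
  low_riordan_path w = low_from false false w.
Proof.
have -> : low_riordan_path w = low_path w && [forall i : 'I_k,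
    ~~ ((tnth w i == Horizontal) && (height (take i w) == 0%R))].
  by rewrite /low_riordan_path /riordan_path /low_path andbAC.
rewrite low_pathE; apply/andP/low_fromP => [[/low_fromP[bnd h0 _] /forallP nh]|].
  split=> // i; rewrite size_tuple => lt_ik hi; rewrite GRing.add0r.
  by have := nh (Ordinal lt_ik); rewrite (tnth_nth Up) hi.
case=> bnd h0 nh; split; first exact/low_fromP.
apply/forallP => i; apply/negP => /andP[/eqP hi hz].
have := nh i; rewrite size_tuple ltn_ord -(tnth_nth Up) hi GRing.add0r hz.
by move=> /(_ isT erefl).
Qed.

Lemma num_reduced_two_nested_low m :
  num_reduced_two_nested m.+1 = num_low true false m.
Proof.
rewrite num_reduced_two_nestedS.
by apply: eq_card => w; rewrite !inE low_pathE.
Qed.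

Lemma num_connected_reduced_two_nested_low m :
  num_connected_reduced_two_nested m.+1 = num_low false false m.
Proof.
rewrite num_connected_reduced_two_nestedS.
by apply: eq_card => w; rewrite !inE low_riordan_pathE.
Qed.

(** * The empty graph and the final assembly *)

Lemma card_area_seq0 (P : pred {ffun 'I_0 -> 'I_0}) :
  (forall a, P a) -> #|[set a | P a]| = 1.
Proof.
move=> PT; rewrite (_ : [set a | P a] = setT) ?cardsT ?card_ffun ?card_ord //.
by apply/setP => a; rewrite !inE PT.
Qed.

Lemma area_seq0 (a : {ffun 'I_0 -> 'I_0}) : area_seq a.
Proof. by apply/andP; split; apply/forallP => -[]. Qed.

Lemma reduced0 (e : rel 'I_0) : reduced e.
Proof. by apply/existsP => -[[]]. Qed.

Lemma two_nested0 (e : rel 'I_0) : two_nested e.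
Proof. by apply/forallP => -[]. Qed.

Theorem proposition6p2 :
  [/\ num_reduced 0 = 1
      /\ (forall n : nat, 1 <= n -> num_reduced n = motzkin (n - 1)),
      num_connected_reduced 0 = 0
      /\ (forall n : nat, 1 <= n -> num_connected_reduced n = riordan (n - 1)),
      [/\ num_reduced_two_nested 0 = 1, num_reduced_two_nested 1 = 1
        & forall n : nat, 2 <= n -> num_reduced_two_nested n = 2 ^ (n - 2)]
    & [/\ num_connected_reduced_two_nested 0 = 0,
          num_connected_reduced_two_nested 1 = 1
        & forall n : nat, 2 <= n ->
            num_connected_reduced_two_nested n = fib (n - 2)]].
Proof.
split; split.
- by apply: card_area_seq0 => a; rewrite area_seq0 reduced0.
- by case=> // m _; rewrite subn1 num_reducedS.
- by apply: eq_card0 => a; rewrite !inE andbF.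
- by case=> // m _; rewrite subn1 num_connected_reducedS.
- by apply: card_area_seq0 => a; rewrite area_seq0 reduced0 two_nested0.
- by rewrite num_reduced_two_nested_low num_low0.
- by case=> [|[|m]] // _; rewrite num_reduced_two_nested_low (num_low_flat m).1 !subSS subn0.
- by apply: eq_card0 => a; rewrite !inE andbF.
- by rewrite num_connected_reduced_two_nested_low num_low0.
case=> [|[|m]] // _.
by rewrite num_connected_reduced_two_nested_low (num_low_noflat m).1 !subSS subn0.
Qed.
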